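(* Let $G$ be a connected vertex-transitive graph with $|V(G)|\geq 3$. Then every induced path of length at most $2$ in $G$ closes to an induced cycle. Moreover, for every integer $\ell\geq 3$ there exist infinitely many connected vertex-transitive graphs each containing an induced path of length $\ell$ that does not close to an induced cycle.
   Context: All graphs are finite, simple and undirected, and graphs are considered up to isomorphism. A path of length $\ell$ in $G$ is a sequence $(x_0,\dots,x_\ell)$ of pairwise distinct vertices with $x_i x_{i+1}\in E(G)$ for $0\le i\le \ell-1$ (length $0$ means a single vertex). A cycle is a sequence $(x_0,\dots,x_{\ell-1},x_\ell=x_0)$ with $\ell\ge 3$, $x_0,\dots,x_{\ell-1}$ pairwise distinct and $x_ix_{i+1}\in E(G)$ for all $0\le i\le\ell-1$. Paths and cycles are identified with the subgraphs formed by their vertices and edges; a path or cycle is induced if this subgraph is an induced subgraph of $G$. An induced path $P$ closes to an induced cycle if there exists an induced cycle $C$ in $G$ such that $P$ is an induced subgraph of $C$. A graph is vertex-transitive if its automorphism group acts transitively on its vertices. *)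

(* Defs.v *)
From HB Require Import structures.
From mathcomp Require Import all_boot all_fingroup.

Set Implicit Arguments.
Unset Strict Implicit.
Unset Printing Implicit Defensive.

Record sgraph := SGraph {
  vertex :> finType;
  edge : rel vertex;
  edge_sym : symmetric edge;
  edge_irr : irreflexive edge
}.

Arguments edge {s}.

Definition graph_iso (G H : sgraph) : Prop :=
  exists f : G -> H, bijective f /\ forall x y, edge (f x) (f y) = edge x y.

Definition connected (G : sgraph) : Prop := forall x y : G, connect edge x y.

Definition graph_aut (G : sgraph) : {set {perm G}} :=
  [set s : {perm G} | [forall x, forall y, edge (s x) (s y) == edge x y]].

Lemma graph_aut_group_set (G : sgraph) : group_set (graph_aut G).
Proof.
apply/group_setP; split=> [|s t].
  by rewrite inE; apply/'forall_forallP => x y; rewrite !perm1.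
rewrite !inE => /'forall_'forall_eqP Hs /'forall_'forall_eqP Ht.
by apply/'forall_'forall_eqP => x y; rewrite !permM Ht Hs.
Qed.

Canonical graph_aut_group (G : sgraph) := Group (graph_aut_group_set G).

Definition vertex_transitive (G : sgraph) : Prop :=
  [transitive graph_aut G, on [set: G] | 'P].

(* Subgraphs of [G], and [G] itself, live on the common ambient type of       *)
(* vertices, so that they can be compared without isomorphisms.               *)
Record subgraph (G : sgraph) := Subgraph {
  sub_verts : {set G};
  sub_edge : rel G
}.

Definition whole (G : sgraph) : subgraph G := Subgraph [set: G] edge.

Definition induced_subgraph (G : sgraph) (H K : subgraph G) : Prop :=
  sub_verts H \subset sub_verts K /\
  {in sub_verts H &, forall x y, sub_edge H x y = sub_edge K x y}.

Definition is_path (G : sgraph) (l : nat) (p : seq G) : Prop :=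
  [/\ size p = l.+1, uniq p & sorted edge p].

(* The cycle (x_0, ..., x_(l-1), x_l = x_0) is encoded by the sequence        *)
(* x_0, ..., x_(l-1), without the repetition of x_0.                          *)
Definition is_cycle (G : sgraph) (c : seq G) : Prop :=
  [/\ 3 <= size c, uniq c & path.cycle edge c].

(* [zip p (behead p)] lists the pairs (x_i, x_(i+1)) of a path;               *)
(* [zip c (rot 1 c)] also contains the closing pair (x_(l-1), x_0).           *)
Definition path_subgraph (G : sgraph) (p : seq G) : subgraph G :=
  let s := zip p (behead p) in
  Subgraph [set x in p] (fun x y => ((x, y) \in s) || ((y, x) \in s)).

Definition cycle_subgraph (G : sgraph) (c : seq G) : subgraph G :=
  let s := zip c (rot 1 c) in
  Subgraph [set x in c] (fun x y => ((x, y) \in s) || ((y, x) \in s)).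

Definition induced_path (G : sgraph) (l : nat) (p : seq G) : Prop :=
  is_path l p /\ induced_subgraph (path_subgraph p) (whole G).

Definition induced_cycle (G : sgraph) (c : seq G) : Prop :=
  is_cycle c /\ induced_subgraph (cycle_subgraph c) (whole G).

Definition closes_to_induced_cycle (G : sgraph) (p : seq G) : Prop :=
  exists c : seq G,
    induced_cycle c /\ induced_subgraph (path_subgraph p) (cycle_subgraph c).

(* Main.v *)
Require Import Defs.
From mathcomp Require Import all_boot all_fingroup ssralg zmodp zify.

(** The first part rests on the following fact, for [b] a vertex of a finite
    vertex-transitive graph: if [D] is a smallest component of G - N[b], then
    every neighbour of [b] with a neighbour outside N[b] has a neighbour in [D].
    By regularity, both ends of an induced path a - b - c have neighbours
    outside N[b], so a shortest path from [a] to [c] through [D] closes the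
    path to an induced cycle.

    For the second part, if every neighbour of x_0 lies in N[x_1] or N[x_2],
    then an induced path x_0, x_1, x_2, x_3, ... cannot close. In the prism
    K_3 [] K_2, N[x_1] and N[x_2] cover everything when x_1 x_2 is a rung; this
    domination survives in the strong product with a long cycle, along which
    the path can be prolonged to any length. *)

Set Implicit Arguments.
Unset Strict Implicit.
Unset Printing Implicit Defensive.

(** * Chordless paths and the subgraphs they form *)

Section Chordless.

Variable G : sgraph.
Implicit Types (a b x y z : G) (p q : seq G) (S : {set G}).

(** Recursive boolean form of an induced path on [x :: q], suited to induction along the path. *)
Fixpoint chordless x q : bool :=
  if q is z :: q' then
    [&& edge x z, x \notin q, ~~ has (edge x) q' & chordless z q']
  else true.

Lemma edgeC x y : edge x y = edge y x.
Proof. exact: edge_sym. Qed.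

Lemma chordless_uniq x q : chordless x q -> uniq (x :: q).
Proof. by elim: q x => //= z q IH x /and4P[_ -> _ /IH]. Qed.

Lemma chordless_path x q : chordless x q -> path edge x q.
Proof. by elim: q x => //= z q IH x /and4P[-> _ _ /IH]. Qed.

Lemma sub_edge_pathC p x y :
  sub_edge (path_subgraph p) x y = sub_edge (path_subgraph p) y x.
Proof. exact: orbC. Qed.

Lemma sub_edge_path_cons x z q y w :
  sub_edge (path_subgraph (x :: z :: q)) y w =
  [|| (y == x) && (w == z), (w == x) && (y == z)
    | sub_edge (path_subgraph (z :: q)) y w].
Proof.
rewrite /= !inE !xpair_eqE.
by case: (_ && _); case: (_ && _); rewrite /= ?orbT.
Qed.

Lemma sub_edge_path_mem p x y :
  sub_edge (path_subgraph p) x y -> x \in p.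
Proof.
elim: p => [|z [|w q] IH] //; rewrite sub_edge_path_cons.
case/or3P => [/andP[/eqP-> _]|/andP[_ /eqP->]|/IH]; rewrite !inE ?eqxx ?orbT //.
by move=> ->; rewrite orbT.
Qed.

Lemma chordless_sub_edge x q : chordless x q ->
  {in x :: q &, forall y z, sub_edge (path_subgraph (x :: q)) y z = edge y z}.
Proof.
elim: q x => [|z q IH] x.
  by move=> _ y w; rewrite !inE => /eqP-> /eqP->; rewrite edge_irr.
case/and4P => xz xNq /hasPn nxq /IH {}IH.
have xE w : w \in z :: q -> edge x w = (w == z).
  rewrite inE; case: eqP => [->//|_ /= wq]; exact/negbTE/nxq.
have xF w : sub_edge (path_subgraph (z :: q)) x w = false.
  by apply/negP => /sub_edge_path_mem; rewrite (negbTE xNq).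
have neq w : w \in z :: q -> (w == x) = false.
  by move=> wq; apply: contraNF xNq => /eqP <-.
move=> y w; rewrite sub_edge_path_cons.
rewrite inE => /predU1P[->|yq]; rewrite inE => /predU1P[->|wq].
- by rewrite xF edge_irr eqxx /= orbF orbb eq_sym neq ?mem_head.
- by rewrite eqxx xF neq //= xE ?orbF.
- by rewrite sub_edge_pathC xF neq // edgeC xE // eqxx /= orbF.
- by rewrite IH // !neq.
Qed.

Lemma chordless_induced_path x q :
  chordless x q -> induced_path (size q) (x :: q).
Proof.
move=> ch; split; first by split; rewrite ?chordless_uniq //= chordless_path.
split; first exact: subsetT.
by move=> y z; rewrite !inE => yq zq; rewrite chordless_sub_edge ?inE.
Qed.

Lemma mem_zip_rcons x p b (y w : G) :
  ((y, w) \in zip (x :: p) (rcons p b)) =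
  ((y, w) \in zip (x :: p) p) || (y == last x p) && (w == b).
Proof.
elim: p x => [|z p IH] x; first by rewrite /= !inE xpair_eqE.
by rewrite /= inE IH [in RHS]inE orbA.
Qed.

(** The only neighbours of [b] on [x :: q] are its two ends, so [b] adds exactly the two closing
    edges. *)
Lemma chordless_induced_cycle b x q : chordless x q -> q != [::] ->
  edge b x -> edge b (last x q) ->
  {in q, forall z, b != z /\ (edge b z -> z = last x q)} ->
  induced_cycle (b :: x :: q).
Proof.
move=> ch qn0 bx bl bq.
have bNx : b != x by apply: contraTneq bx => ->; rewrite edge_irr.
have bNq : b \notin x :: q.
  by rewrite inE negb_or bNx; apply/negP => /bq[]; rewrite eqxx.
split; first split.
- by case: q qn0 {ch bl bq bNq}.
- by rewrite cons_uniq bNq chordless_uniq.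
- by rewrite /= bx rcons_path chordless_path //= edgeC.
split=> [|y w]; first exact: subsetT.
have bE w' : w' \in x :: q -> edge b w' = (w' == x) || (w' == last x q).
  rewrite inE => /predU1P[->|/bq[_ h]]; first by rewrite eqxx bx.
  apply/idP/orP => [/h ->|[] /eqP-> //]; by right.
have subE y' w' : sub_edge (cycle_subgraph (b :: x :: q)) y' w' =
   [|| (y' == b) && (w' == x), (w' == b) && (y' == x),
       (y' == last x q) && (w' == b), (w' == last x q) && (y' == b)
     | sub_edge (path_subgraph (x :: q)) y' w'].
  have zE : zip (b :: x :: q) (rot 1 (b :: x :: q)) =
            (b, x) :: zip (x :: q) (rcons q b).
    by rewrite rot1_cons.
  rewrite /cycle_subgraph zE {zE}; cbn [sub_edge].
  rewrite !inE !mem_zip_rcons !xpair_eqE.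
  by do 4!case: (_ && _); rewrite /= ?orbT ?orbF.
have neq z : z \in x :: q -> (z == b) = false.
  by move=> wq; apply: contraNF bNq => /eqP <-.
have bF w' : sub_edge (path_subgraph (x :: q)) b w' = false.
  by apply/negP => /sub_edge_path_mem; rewrite (negbTE bNq).
have neq' z : z \in x :: q -> (b == z) = false by rewrite eq_sym; exact: neq.
have lq : last x q \in x :: q by exact: mem_last.
rewrite [sub_verts _]/= 2!in_set [sub_edge (whole G) _ _]/= subE.
rewrite in_cons => /predU1P[->|yq]; rewrite in_cons => /predU1P[->|wq].
- by rewrite edge_irr eqxx bF !neq' ?mem_head.
- by rewrite eqxx bF neq //= andbF andbT /= orbF bE.
- by rewrite eqxx sub_edge_pathC bF neq //= !andbT andbF /= orbF edgeC bE.
- by rewrite chordless_sub_edge // !neq // !andbF.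
Qed.

(* Jump from [x] to the last vertex of the path it sees. *)
Lemma chordless_shortcut x z q : chordless z q -> last z q != x ->
  has (edge x) (z :: q) || (x \in z :: q) ->
  exists q', [/\ chordless x q', last x q' = last z q & {subset q' <= z :: q}].
Proof.
elim: q z => [|w q IH] z.
  rewrite /= !inE orbF => _ /negbTE zx; rewrite eq_sym zx orbF => xz.
  by exists [:: z]; split=> //=; rewrite xz !inE eq_sym zx.
move=> ch lx H; case/and4P: (ch) => zw zNq nzq chw.
case Hwq: (has (edge x) (w :: q) || (x \in w :: q)).
  have [q' [ch' l' s']] := IH w chw lx Hwq.
  by exists q'; split=> // t /s' tq; rewrite inE tq orbT.
case/norP: Hwq => nh nm.
rewrite -[has _ _]/(edge x z || has (edge x) (w :: q)) in H.
move: H; rewrite in_cons (negbTE nh) (negbTE nm) !orbF.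
(* Only [z] remains: either [x] sees it and is put in front of the whole path, or [x] is [z] and the
   path already starts at [x]. *)
case/orP => [xz|/eqP xz].
  exists [:: z, w & q]; split=> //.
  apply/and4P; split=> //; rewrite inE negb_or nm andbT.
  by apply: contraTneq xz => ->; rewrite edge_irr.
by exists (w :: q); split; [rewrite xz| |move=> t tq; rewrite inE tq orbT].
Qed.

(** Induction on the walk: a chordless path from its second vertex is extended back to [x] by
    [chordless_shortcut]. Only vertices entered must lie in [S], so [x] may lie outside. *)
Lemma connect_chordless S x y : x != y ->
  connect [rel u v | edge u v && (v \in S)] x y ->
  exists q, [/\ chordless x q, last x q = y & {subset q <= S}].
Proof.
move=> xy /connectP[p pp ly]; elim: p x xy pp ly => [|z p IH] x xy.
  by move=> _ e; rewrite e eqxx in xy.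
case/andP => /andP[xz zS] pp ly.
have [zy|zy] := eqVneq z y.
  exists [:: z]; split=> //=.
    by rewrite xz inE zy xy.
  by move=> t; rewrite inE => /eqP->.
have [q [chq lq sq]] := IH z zy pp ly.
have [|/=|q' [ch' l' s']] := chordless_shortcut (x := x) chq.
- by rewrite lq eq_sym.
- by rewrite xz.
exists q'; split; rewrite ?l' // => t /s'; rewrite inE => /predU1P[->//|/sq //].
Qed.

(** Path and cycle both take their edges from [G], so containment of vertices is enough. *)
Lemma induced_path_closes l p c : induced_path l p -> induced_cycle c ->
  {subset p <= c} -> closes_to_induced_cycle p.
Proof.
move=> [_ [_ pE]] ic pc; exists c; split=> //; split.
  by apply/subsetP => x; rewrite !inE => /pc.
case: ic => _ [_ cE] x y xp yp; rewrite pE // cE //; rewrite !inE in xp yp *;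
exact: pc.
Qed.

End Chordless.

(** * Components of G - N[v], a graph with vertex set [far v] *)

Section Components.

Variable G : sgraph.
Implicit Types (a b u v x y z : G) (s : {perm G}) (A C D : {set G}).

Definition far v : {set G} := [set x | (x != v) && ~~ edge v x].

Definition far_edge v : rel G :=
  [rel x y | [&& edge x y, x \in far v & y \in far v]].

(** For [x] in [far v] this is its component in G - N[v]; for other [x] it is the singleton of
    [x]. *)
Definition comp v x : {set G} := [set y | connect (far_edge v) x y].

Definition comps v : {set {set G}} := comp v @: far v.

Lemma far_sym u v : (u \in far v) = (v \in far u).
Proof. by rewrite !inE eq_sym edgeC. Qed.

Lemma far_irr v : v \notin far v.
Proof. by rewrite inE eqxx. Qed.

Lemma far_edge_connect_sym v : connect_sym (far_edge v).
Proof.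
apply: sym_connect_sym => x y; rewrite /far_edge /= edgeC.
by congr (_ && _); rewrite andbC.
Qed.

Lemma comp_id v x : x \in comp v x.
Proof. by rewrite inE connect0. Qed.

Lemma comp_eq v x y : y \in comp v x -> comp v y = comp v x.
Proof.
rewrite inE => xy; apply/setP => z; rewrite !inE.
by rewrite (same_connect (@far_edge_connect_sym v) xy).
Qed.

Lemma comp_far v x y : x \in far v -> y \in comp v x -> y \in far v.
Proof.
rewrite [y \in _]inE => xv xy; rewrite -(closed_connect _ xy) //.
by move=> t w /and3P[_ -> ->].
Qed.

Lemma comp_edge v x y : x \in far v -> y \in far v -> edge x y -> y \in comp v x.
Proof. by move=> xv yv xy; rewrite inE; apply: connect1; rewrite /far_edge /= xy xv. Qed.

(** A walk outside N[u] that stays in [far v] is also a walk outside N[v]. *)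
Lemma comp_sub u v x : comp u x \subset far v -> comp u x \subset comp v x.
Proof.
move=> uv; apply/subsetP => y; rewrite inE => /connectP[p pp ->] {y}.
elim: p x uv pp => [|z p IH] x uv /=; first by rewrite comp_id.
case/andP => xz pp.
have zx : z \in comp u x by rewrite inE; apply: connect1.
have zv : z \in comp v x.
  case/and3P: (xz) => exz _ _.
  by apply: comp_edge exz; apply: (subsetP uv); rewrite ?comp_id.
by rewrite -(comp_eq zv); apply: IH => //; rewrite (comp_eq zx).
Qed.

Lemma comps_eq v A x : A \in comps v -> x \in A -> x \in far v /\ A = comp v x.
Proof.
by case/imsetP => y yv -> xy; rewrite (comp_far yv xy) (comp_eq xy).
Qed.

Lemma graph_autE s x y : s \in graph_aut G -> edge (s x) (s y) = edge x y.
Proof. by rewrite inE => /'forall_'forall_eqP. Qed.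

Lemma far_aut s v x : s \in graph_aut G -> (s x \in far (s v)) = (x \in far v).
Proof. by move=> sA; rewrite !inE graph_autE // (inj_eq perm_inj). Qed.

Lemma connect_far_aut s v x y : s \in graph_aut G ->
  connect (far_edge v) x y -> connect (far_edge (s v)) (s x) (s y).
Proof.
move=> sA /connectP[p pp ->]; apply/connectP.
exists (map s p); last by rewrite last_map.
by apply: homo_path pp => u w; rewrite /far_edge /= graph_autE // !far_aut.
Qed.

Lemma comp_aut s v x : s \in graph_aut G -> comp (s v) (s x) = s @: comp v x.
Proof.
move=> sA; apply/setP => y; rewrite -[y](permKV s) (mem_imset _ _ (@perm_inj _ s)).
rewrite !inE; apply/idP/idP; last exact: connect_far_aut.
have sV : (s^-1)%g \in graph_aut G by rewrite groupV.
by move/(connect_far_aut sV); rewrite !permK.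
Qed.

Lemma comps_aut s v : s \in graph_aut G ->
  comps (s v) = [set s @: A | A : {set G} in comps v].
Proof.
move=> sA; apply/setP => A; apply/imsetP/imsetP.
  case=> x xv ->; exists (comp v ((s^-1)%g x)).
    by apply: imset_f; rewrite -(far_aut _ _ sA) permKV.
  by rewrite -comp_aut // permKV.
case=> _ /imsetP[x xv ->] ->; exists (s x); first by rewrite far_aut.
by rewrite comp_aut.
Qed.

(** * Vertex-transitivity: equal counts and induced cycles through a - b - c *)

Hypothesis trG : vertex_transitive G.

Lemma aut_exists x y : exists2 s, s \in graph_aut G & y = s x.
Proof.
have [s sA e] := atransP2 trG (in_setT x) (in_setT y).
by exists s.
Qed.

Lemma card_comps u v : #|comps u| = #|comps v|.
Proof.
have [s sA ->] := aut_exists v u; rewrite comps_aut // card_imset //.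
exact/imset_inj/perm_inj.
Qed.

Lemma comps_card u v A : A \in comps u -> exists2 B, B \in comps v & #|B| = #|A|.
Proof.
have [s sA ->] := aut_exists v u; rewrite comps_aut // => /imsetP[B Bv ->].
by exists B => //; rewrite card_imset //; exact: perm_inj.
Qed.

Lemma card_neighbors u v : #|[set x | edge u x]| = #|[set x | edge v x]|.
Proof.
have [s sA ->] := aut_exists v u; rewrite -[RHS](card_imset _ (@perm_inj _ s)).
apply: eq_card => y; rewrite -[y](permKV s) (mem_imset _ _ (@perm_inj _ s)) !inE.
exact: graph_autE.
Qed.

(* For [u] in [D], a component of G - N[u] avoiding [b] is either inside      *)
(* D - u, contradicting minimality, or a component of G - N[b] other than D.  *)
(* Both graphs have equally many components, so every component other than D  *)
(* stays separated from [b] after deleting N[u]: its neighbours lie in N(u).  *)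
Lemma smallest_comp_attaches b D C a y : D \in comps b ->
  {in comps b, forall E : {set G}, #|D| <= #|E|} ->
  C \in comps b -> edge b a -> y \in C -> edge a y ->
  exists2 u, u \in D & edge a u.
Proof.
move=> Db minD Cb ba yC ay.
have [<-|CD] := eqVneq C D; first by exists y.
have [u ub Du] : exists2 u, u \in far b & D = comp b u.
  by case/imsetP: Db => u; exists u.
have bu : b \in far u by rewrite far_sym.
exists u; first by rewrite Du comp_id.
have sub : comps u :\ comp u b \subset comps b :\ D.
  apply/subsetP => E; rewrite 2!in_setD1 => /andP[Eb Eu].
  case/imsetP: (Eu) => x xu Ex.
  have bNE : b \notin E by apply: contra Eb => /(comps_eq Eu)[_ ->].
  have Efar : comp u x \subset far b.
    rewrite -Ex; apply/subsetP => z zE; rewrite inE; apply/andP; split.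
      by apply: contraNneq bNE => <-.
    apply: contra bNE => bz; have [zu ->] := comps_eq Eu zE.
    by apply: comp_edge; rewrite // edgeC.
  have EC := comp_sub Efar.
  have xb : x \in far b by rewrite (subsetP Efar) ?comp_id.
  (* If [E] lies inside [D], it misses [u]; an automorphism taking [u] to [b] maps it to a component
     of G - N[b] smaller than [D]. *)
  have [xD|xD] := eqVneq (comp b x) D.
    have [E' /minD le eE] := comps_card b Eu.
    move: le; rewrite eE leqNgt proper_card //; apply/properP; split.
      by rewrite Ex -xD.
    exists u; first by rewrite Du comp_id.
    by rewrite Ex; apply/negP => /(comp_far xu); rewrite (negbTE (far_irr u)).
  (* Otherwise the component of [x] in G - N[b] avoids N[u], as [u] lies in [D]; so it lies inside
     [E] and the two coincide. *)
  have Cfar : comp b x \subset far u.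
    apply/subsetP => z zx; rewrite inE; apply/andP; split.
      by apply: contraNneq xD => e; rewrite Du -e (comp_eq zx).
    apply: contra xD => uz; rewrite -(comp_eq zx) Du.
    by apply/eqP/comp_eq/comp_edge => //; apply: comp_far zx.
  have -> : E = comp b x by apply/eqP; rewrite eqEsubset Ex EC comp_sub.
  by rewrite xD imset_f.
have /eqP eqs : comps u :\ comp u b == comps b :\ D.
  rewrite eqEcard sub /=.
  have := cardsD1 (comp u b) (comps u); have := cardsD1 D (comps b).
  by rewrite Db imset_f // (card_comps u b) => -> /addnI ->.
have : C \in comps u :\ comp u b by rewrite eqs !inE CD.
(* If [a] did not see [u], the path from [y] through [a] to [b] would avoid N[u] and make [C] the
   component of [b]. *)
case/setD1P => Cub Cu; apply: contraNT Cub => au.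
have [yu Cy] := comps_eq Cu yC.
have afar : a \in far u.
  rewrite inE edgeC au andbT; apply: contraTneq ub => <-.
  by rewrite inE ba andbF.
have aC : a \in C by rewrite Cy; apply: comp_edge; rewrite // edgeC.
have [_ Ca] := comps_eq Cu aC.
by apply/eqP/esym; rewrite Ca; apply/comp_eq/comp_edge; rewrite // edgeC.
Qed.

(** Otherwise N(a) - b is contained in N(b) - a; by regularity the two sets are equal, and the
    second contains [c]. *)
Lemma neighbor_far a b c : edge b a -> edge b c -> c != a -> ~~ edge a c ->
  exists2 y, y \in far b & edge a y.
Proof.
move=> ba bc ca ac; apply/exists_inP; apply: contraNT ac => /exists_inPn nex.
have sub : [set x | edge a x] :\ b \subset [set x | edge b x] :\ a.
  apply/subsetP => x; rewrite !inE => /andP[xb ax].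
  apply/andP; split; first by apply: contraTneq ax => ->; rewrite edge_irr.
  by apply: contraLR (ax) => bx; apply: nex; rewrite inE xb.
have /eqP eqs : [set x | edge a x] :\ b == [set x | edge b x] :\ a.
  rewrite eqEcard sub /=.
  have := cardsD1 b [set x | edge a x]; have := cardsD1 a [set x | edge b x].
  by rewrite !inE ba edgeC ba (card_neighbors a b) => -> /addnI ->.
have : c \in [set x | edge b x] :\ a by rewrite !inE ca.
by rewrite -eqs !inE => /andP[].
Qed.

Lemma cherry_in_induced_cycle a b c : edge b a -> edge b c -> c != a ->
  ~~ edge a c -> exists2 C, induced_cycle C & {subset [:: a; b; c] <= C}.
Proof.
move=> ba bc ca ac.
have [y yb ay] := neighbor_far ba bc ca ac.
have [z zb cz] : exists2 z, z \in far b & edge c z.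
  by apply: neighbor_far bc ba _ _; rewrite 1?eq_sym // edgeC.
have yb' : comp b y \in comps b by apply: imset_f.
have [D Db minD] : exists2 D, D \in comps b &
    {in comps b, forall E : {set G}, #|D| <= #|E|}.
  by case: (arg_minnP (fun E : {set G} => #|E|) yb') => D; exists D.
have [u uD au] := smallest_comp_attaches Db minD yb' ba (comp_id b y) ay.
have zb' : comp b z \in comps b by apply: imset_f.
have [v vD cv] := smallest_comp_attaches Db minD zb' bc (comp_id b z) cz.
have [ub Du] := comps_eq Db uD.
have Dfar x : x \in D -> x \in far b by case/(comps_eq Db).
(* Only the vertex entered is tested, so a walk may start at [a]. Interior vertices of the resulting
   path lie in [D], hence outside N[b]. *)
pose e := [rel t w | edge t w && (w \in c |: D)].
have conn : connect e a c.
  apply: connect_trans (_ : connect e a u) _.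
    by apply: connect1; rewrite /e /= au !inE uD orbT.
  apply: connect_trans (_ : connect e u v) _; last first.
    by apply: connect1; rewrite /e /= edgeC cv !inE eqxx.
  move: vD; rewrite Du inE => /connectP[p pp ->].
  move: (comp_id b u); rewrite -Du; elim: p {uD ub Du au cv} u pp => //= t p IH u.
  case/andP => /and3P[ut ub tb] pp uD.
  have tD : t \in D by have [_ ->] := comps_eq Db uD; apply: comp_edge.
  by apply: connect_trans (IH t pp tD); apply: connect1; rewrite /e /= ut !inE tD orbT.
have [|q [chq lq sq]] := connect_chordless _ conn; first by rewrite eq_sym.
exists [:: b, a & q]; last first.
  have := mem_last a q; rewrite lq => cq.
  move=> x; rewrite 3!inE => /or3P[] /eqP->; rewrite in_cons ?cq ?orbT //.
    by rewrite mem_head orbT.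
  by rewrite eqxx.
apply: chordless_induced_cycle => //; rewrite ?lq //.
  by apply: contraNneq ca => q0; rewrite -lq q0.
move=> x /sq /setU1P[->|/Dfar].
  by split=> //; apply: contraTneq bc => ->; rewrite edge_irr.
by rewrite inE eq_sym => /andP[-> /negbTE ->].
Qed.

(** * Closing induced paths of length at most 2 *)

Hypothesis conG : connected G.
Hypothesis card_G : 3 <= #|G|.

Lemma connected_closed_full A x : x \in A ->
  (forall y z, y \in A -> edge y z -> z \in A) -> #|G| = #|A|.
Proof.
move=> xA clA; apply/esym/eq_card => y; rewrite [RHS]inE.
rewrite -(closed_connect _ (conG x y)) // => t w tw.
by apply/idP/idP => [tA|wA]; [apply: clA tw|apply: clA wA _; rewrite edgeC].
Qed.

Lemma neighbor_exists x : exists y, edge x y.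
Proof.
apply/existsP; apply: contraLR card_G => /existsPn nx.
rewrite (@connected_closed_full [set x] x) ?cards1 ?set11 // => y z /set1P-> xz.
by case/negP: (nx z).
Qed.

(** If [b] had degree 1, so would [a] by regularity, and the edge would be all of the connected
    graph. *)
Lemma second_neighbor_exists a b : edge a b -> exists2 c, edge b c & c != a.
Proof.
move=> ab; suff /existsP[c /andP[bc ca]] : [exists c, edge b c && (c != a)] by exists c.
apply: contraLR card_G => /existsPn nex.
have bE c : edge b c -> c = a.
  by move=> bc; apply/eqP; have := nex c; rewrite bc /= negbK.
have Nb : [set c | edge b c] = [set a].
  apply/setP => c; rewrite !inE; apply/idP/eqP => [/bE //|->]; by rewrite edgeC.
have aE c : edge a c -> c = b.
  move=> ac; have /eqP/cards1P[d Na] : #|[set x | edge a x]| = 1.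
    by rewrite (card_neighbors a b) Nb cards1.
  have : c \in [set x | edge a x] by rewrite inE.
  have : b \in [set x | edge a x] by rewrite inE.
  by rewrite Na !inE => /eqP-> /eqP.
rewrite (@connected_closed_full [set a; b] a) ?set21 //.
  by rewrite cards2; case: (_ != _).
by move=> y z /set2P[] -> yz; [rewrite (aE _ yz) set22|rewrite (bE _ yz) set21].
Qed.

(** A second neighbour of [b] yields either a triangle or an induced path of length 2 centred at
    [b]. *)
Lemma edge_in_induced_cycle a b : edge a b ->
  exists2 C, induced_cycle C & {subset [:: a; b] <= C}.
Proof.
move=> ab; have [c bc ca] := second_neighbor_exists ab.
have [ac|ac] := boolP (edge a c).
  exists [:: b; a; c].
    apply: chordless_induced_cycle => //=.
    - by rewrite /= ac inE eq_sym ca.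
    - by rewrite edgeC.
    move=> z; rewrite inE => /eqP->; split=> //.
    by apply: contraTneq bc => ->; rewrite edge_irr.
  by move=> z; rewrite !inE => /orP[] ->; rewrite ?orbT.
have [||||C iC sC] := @cherry_in_induced_cycle a b c => //; first by rewrite edgeC.
exists C => // z; rewrite !inE => zab; apply: sC; rewrite !inE.
by case/orP: zab => ->; rewrite ?orbT.
Qed.

Lemma short_induced_path_closes l (p : seq G) :
  l <= 2 -> induced_path l p -> closes_to_induced_cycle p.
Proof.
move=> l2 ip; suff [C iC sC] : exists2 C, induced_cycle C & {subset p <= C}.
  exact: induced_path_closes ip iC sC.
case: ip => [[sp up pp] [_ pE]]; case: p sp up pp pE l2 => [|a [|b [|c [|d p]]]] //=.
- move=> _ _ _ _ _; have [b ab] := neighbor_exists a.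
  have [C iC sC] := edge_in_induced_cycle ab.
  by exists C => // z; rewrite inE => /eqP->; apply: sC; rewrite mem_head.
- by move=> _ _ /andP[ab _] _ _; apply: edge_in_induced_cycle.
- rewrite !inE => _ /and3P[/norP[ab ac] bc _] /and3P[eab ebc _] pE _.
  apply: cherry_in_induced_cycle => //; rewrite 1?edgeC // 1?eq_sym //.
  rewrite -pE ?inE ?eqxx ?orbT // !xpair_eqE (eq_sym c b) (eq_sym c a).
  by rewrite (negbTE ab) (negbTE ac) (negbTE bc) !andbF.
- by case=> <-.
Qed.

End Components.

(** * Neighbours along a cycle *)

Lemma fpath_map_belast (T : eqType) (f : T -> T) x p :
  fpath f x p -> map f (belast x p) = p.
Proof. by elim: p x => //= y p IH x /andP[/eqP-> /IH ->]. Qed.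

Section CycleDegree.

Variables (G : sgraph) (c : seq G).
Hypothesis uniq_c : uniq c.
Implicit Types x y z : G.

(** [rot 1 c] is [c] with [next] applied entrywise, so the listed pairs form the graph of [next]. *)
Lemma mem_zip_rot1 x y :
  ((x, y) \in zip c (rot 1 c)) = (x \in c) && (y == next c x).
Proof.
case: c uniq_c => // z q uc; set f := next (z :: q).
have fE : map f (z :: q) = rot 1 (z :: q).
  by have /fpath_map_belast := cycle_next uc; rewrite belast_rcons rot1_cons.
rewrite -fE -{1}(map_id (z :: q)) zip_map.
apply/mapP/andP => [[t tq [-> ->]]|[xq /eqP ->]]; last by exists x.
by rewrite eqxx.
Qed.

Lemma sub_edge_cycle x y : x \in c ->
  sub_edge (cycle_subgraph c) x y = (y == next c x) || (y == prev c x).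
Proof.
move=> xc; rewrite /= !mem_zip_rot1 xc /=; congr (_ || _).
apply/andP/eqP => [[yc /eqP ->]|->]; first by rewrite prev_next.
by rewrite mem_prev next_prev.
Qed.

Lemma cycle_degree x y z w : x \in c ->
  sub_edge (cycle_subgraph c) x y -> sub_edge (cycle_subgraph c) x z ->
  sub_edge (cycle_subgraph c) x w -> [|| y == z, y == w | z == w].
Proof.
move=> xc; rewrite !sub_edge_cycle //.
by do 3!case/orP=> /eqP ->; rewrite eqxx ?orbT.
Qed.

Lemma next_neq_prev x : 3 <= size c -> x \in c -> next c x != prev c x.
Proof.
move=> c3 xc; have [i q def_c] := rot_to xc.
rewrite -(next_rot i uniq_c) -(prev_rot i uniq_c) def_c.
have : uniq (x :: q) by rewrite -def_c rot_uniq.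
have : size (x :: q) = size c by rewrite -def_c size_rot.
case: q {def_c} => [|y [|z q]]; rewrite ?[size _]/= => e;
  try by rewrite -e in c3.
rewrite 2!cons_uniq => /and3P[xq yq _].
(* [x] is absent from the tail, so its index there is the length of the tail, which points at the
   last entry of the whole list. *)
have -> : prev [:: x, y, z & q] x = last z q.
  rewrite prev_nth mem_head memNindex //.
  by rewrite -[size _]/((size [:: x, y, z & q]).-1) nth_last.
by rewrite /= eqxx; apply: contraNneq yq => ->; rewrite mem_last.
Qed.

End CycleDegree.

(* In an induced cycle through the path, the second neighbour of [x0] would   *)
(* be a third neighbour of [x1] or of [x2].                                   *)
Lemma dominated_end_not_closes (G : sgraph) (x0 x1 x2 x3 : G) q :
  chordless x0 [:: x1, x2, x3 & q] ->
  (forall w, edge x0 w -> [|| w == x1, w == x2, edge x1 w | edge x2 w]) ->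
  ~ closes_to_induced_cycle [:: x0, x1, x2, x3 & q].
Proof.
set p := [:: x0, _, _, _ & q] => ch dom [c [[[c3 uc _] [_ cE]] [sub pE]]].
have pc x : x \in p -> x \in c by move=> xp; have := subsetP sub x; rewrite !inE; apply.
have Ec x y : x \in c -> y \in c -> sub_edge (cycle_subgraph c) x y = edge x y.
  by move=> xc yc; rewrite cE ?inE.
have [p0 p1 p2 p3] : [/\ x0 \in p, x1 \in p, x2 \in p & x3 \in p].
  by rewrite !inE !eqxx !orbT.
have [c0 c1 c2 c3'] := And4 (pc _ p0) (pc _ p1) (pc _ p2) (pc _ p3).
case/and4P: ch => e01 x0N n0 /and4P[e12 x1N n1 /and4P[e23 x2N _ _]].
have [w [wc e0w wx1]] : exists w, [/\ w \in c, edge x0 w & w != x1].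
  have := next_neq_prev uc c3 c0.
  have en : edge x0 (next c x0) by rewrite -Ec ?mem_next // sub_edge_cycle ?eqxx.
  have ep : edge x0 (prev c x0).
    by rewrite -Ec ?mem_prev // sub_edge_cycle ?eqxx ?orbT.
  have [<- np|nx _] := eqVneq (next c x0) x1.
    by exists (prev c x0); rewrite mem_prev eq_sym.
  by exists (next c x0); rewrite mem_next.
move: n0; rewrite /= !negb_or => /and3P[n02 n03 _].
have wx2 : w != x2 by apply: contraTneq e0w => ->.
have wx3 : w != x3 by apply: contraTneq e0w => ->.
have wx0 : w != x0 by apply: contraTneq e0w => ->; rewrite edge_irr.
have := dom w e0w; rewrite (negbTE wx1) (negbTE wx2) /= => /orP[e1w|e2w].
- have := @cycle_degree G c uc x1 x0 x2 w c1.
  rewrite !Ec // [edge x1 x0]edgeC e01 e12 e1w => /(_ isT isT isT).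
  rewrite [x0 == w]eq_sym [x2 == w]eq_sym (negbTE wx0) (negbTE wx2).
  by move: x0N; rewrite !inE !negb_or => /and4P[_ /negbTE ->].
(* Length at least 3 enters here: [x3] is the second path neighbour of [x2], so [w] is a third. *)
- have := @cycle_degree G c uc x2 x1 x3 w c2.
  rewrite !Ec // [edge x2 x1]edgeC e12 e23 e2w => /(_ isT isT isT).
  rewrite [x1 == w]eq_sym [x3 == w]eq_sym (negbTE wx1) (negbTE wx3).
  by move: x1N; rewrite !inE !negb_or => /and3P[_ /negbTE ->].
Qed.

(** * The strong product of a prism and a cycle *)

Section PrismStrongCycle.

Local Open Scope ring_scope.
Import GRing.Theory.

Variable n : nat.

Definition cyc_close (j k : 'I_n.+2) : bool :=
  [|| j == k, k == j + 1 | j == k + 1].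

(* The strong product of the prism K_3 [] K_2 with the cycle of length n + 2; *)
(* [cyc_close] and [psc_close] are adjacency or equality.                     *)
Definition psc_vertex : finType := ('I_3 * 'I_2 * 'I_n.+2)%type.

Definition psc_close (x y : psc_vertex) : bool :=
  ((x.1.1 == y.1.1) || (x.1.2 == y.1.2)) && cyc_close x.2 y.2.

Definition psc_edge : rel psc_vertex := [rel x y | (x != y) && psc_close x y].

Lemma psc_edge_sym : symmetric psc_edge.
Proof.
move=> x y; rewrite /psc_edge /= /psc_close /cyc_close eq_sym.
rewrite (eq_sym x.1.1) (eq_sym x.1.2) (eq_sym x.2).
by congr (_ && (_ && (_ || _))); rewrite orbC.
Qed.

Lemma psc_edge_irr : irreflexive psc_edge.
Proof. by move=> x; rewrite /psc_edge /= eqxx. Qed.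

Definition psc : sgraph := SGraph psc_edge_sym psc_edge_irr.

Definition psc_shift (t x : psc_vertex) : psc_vertex :=
  (x.1.1 + t.1.1, x.1.2 + t.1.2, x.2 + t.2).

Lemma psc_shift_inj t : injective (psc_shift t).
Proof.
move=> [[a b] k] [[a' b'] k'] e.
have /addIr -> : a + t.1.1 = a' + t.1.1 := congr1 (fun x : psc_vertex => x.1.1) e.
have /addIr -> : b + t.1.2 = b' + t.1.2 := congr1 (fun x : psc_vertex => x.1.2) e.
by have /addIr -> : k + t.2 = k' + t.2 := congr1 snd e.
Qed.

(** Closeness depends only on coordinate differences, so translations are automorphisms; translation
    by [y] takes the origin to [y]. *)
Lemma psc_vertex_transitive : vertex_transitive psc.
Proof.
pose x0 : psc := (0, 0, 0).
apply/imsetP; exists x0; first exact: in_setT.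
apply/setP => y; rewrite in_setT; apply/esym/orbitP.
exists (perm (@psc_shift_inj y)); last first.
  by rewrite /= apermE permE /psc_shift /= !add0r; case: y => [[]].
rewrite inE; apply/'forall_'forall_eqP => u v; rewrite !permE /=.
rewrite /psc_edge /= (inj_eq (@psc_shift_inj y)) /psc_close /cyc_close /=.
rewrite !(inj_eq (addIr _)) !(addrAC _ y.2 1) !(inj_eq (addIr _)).
by [].
Qed.

Lemma psc_close_connect (x y : psc) : psc_close x y -> connect edge x y.
Proof.
have [-> _|xy cl] := eqVneq x y; first exact: connect0.
by apply: connect1; rewrite /= /psc_edge /= xy.
Qed.

Lemma psc_connected : connected psc.
Proof.
move=> [[a b] k] [[a' b'] k'].
have layer (m : nat) : connect edge ((a, b, k) : psc) ((a, b, k + m%:R) : psc).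
  elim: m => [|m IH]; first by rewrite addr0 connect0.
  apply: connect_trans IH (psc_close_connect _).
  by rewrite /psc_close /cyc_close /= mulrSr addrA !eqxx !orbT.
(* [k' - k], read as a natural number, is the number of layers to climb; two moves within the layer
   then fix the prism coordinates. *)
have := layer (k' - k : 'I_n.+2); rewrite natr_Zp addrC subrK => c1.
apply: connect_trans c1 _.
apply: (@connect_trans _ _ ((a', b, k') : psc)); apply: psc_close_connect.
  by rewrite /psc_close /cyc_close /= !eqxx orbT.
by rewrite /psc_close /cyc_close /= !eqxx.
Qed.

Lemma psc_card : #|psc| = (6 * n.+2)%N.
Proof. by rewrite !card_prod !card_ord. Qed.

Lemma natr_ord_eq (j k : nat) : (j < n.+2)%N -> (k < n.+2)%N ->
  (j%:R == k%:R :> 'I_n.+2) = (j == k).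
Proof. by move=> hj hk; rewrite -val_eqE /= !Zp_nat /= !modn_small. Qed.

(** The bound [n] keeps [k + 1] below the modulus, so nothing wraps around. *)
Lemma cyc_close_nat (j k : nat) : (j <= k)%N -> (k <= n)%N ->
  cyc_close j%:R k%:R = (k <= j.+1)%N.
Proof. by move=> jk kn; rewrite /cyc_close -!mulrSr !natr_ord_eq; lia. Qed.

Definition psc_tail (k : nat) : psc := (1 + 1, 1, k%:R).

Lemma psc_tail_edge j k : (j < k)%N -> (k <= n)%N ->
  edge (psc_tail j) (psc_tail k) = (k == j.+1).
Proof.
move=> jk kn; rewrite /= /psc_edge /= /psc_close /= cyc_close_nat //; last exact: ltnW.
by rewrite /psc_tail xpair_eqE natr_ord_eq; lia.
Qed.

Lemma psc_corner_edge k : (0 < k <= n)%N ->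
  edge ((1, 1, 0) : psc) (psc_tail k) = (k == 1%N).
Proof.
case/andP=> k0 kn; rewrite /= /psc_edge /= /psc_close /=.
by rewrite -[cyc_close 0 _]/(cyc_close 0%:R _) cyc_close_nat //=; lia.
Qed.

Lemma psc_bottom_edge (a : 'I_3) k : a != 1 + 1 ->
  edge ((a, 0, 0) : psc) (psc_tail k) = false.
Proof. by move=> /negbTE a2; rewrite /= /psc_edge /= /psc_close /= a2 andbF. Qed.

Lemma psc_tail_chordless j m : (j + m <= n)%N ->
  chordless (psc_tail j) (map psc_tail (iota j.+1 m)).
Proof.
elim: m j => // m IH j jm.
have notin : psc_tail j \notin map psc_tail (iota j.+1 m.+1).
  apply/negP => /mapP[k]; rewrite mem_iota => kb /eqP.
  by rewrite /psc_tail xpair_eqE natr_ord_eq; lia.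
apply/and4P; split=> //.
- by rewrite psc_tail_edge; lia.
- apply/hasPn => _ /mapP[k kb ->]; move: kb; rewrite mem_iota => kb.
  by rewrite psc_tail_edge; lia.
- by apply: IH; lia.
Qed.

(** The prism vertices (0, 0) and (1, 0) share no coordinate with (2, 1), over which the tail runs.
    The tail starts in layer 1 because (1, 1, 0) sees both (2, 1, 0) and (2, 1, 1). *)
Lemma psc_path_chordless m : (m <= n)%N ->
  chordless ((0, 0, 0) : psc)
    [:: (1, 0, 0), (1, 1, 0) & map psc_tail (iota 1 m)].
Proof.
move=> mn; apply/and4P; split=> //.
- by rewrite !inE; apply/negP => /mapP[].
- by apply/hasPn => x; rewrite inE => /predU1P[->//|/mapP[k _ ->]]; rewrite psc_bottom_edge.
apply/and4P; split=> //.
- by rewrite !inE; apply/negP => /mapP[].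
- by apply/hasPn => x /mapP[k _ ->]; rewrite psc_bottom_edge.
case: m mn => // m mn.
have notin : ((1, 1, 0) : psc) \notin map psc_tail (iota 1 m.+1).
  by apply/negP => /mapP[].
apply/and4P; split=> //.
- apply/hasPn => _ /mapP[k kb ->]; move: kb; rewrite mem_iota => kb.
  by rewrite psc_corner_edge; lia.
- by apply: psc_tail_chordless; lia.
Qed.

(** The layer of [w] is close to 0, and the second coordinate of [w] agrees with that of one end of
    the rung. *)
Lemma psc_path_dominated (w : psc) : edge ((0, 0, 0) : psc) w ->
  [|| w == (1, 0, 0), w == (1, 1, 0), edge ((1, 0, 0) : psc) w
    | edge ((1, 1, 0) : psc) w].
Proof.
case: w => [[a b] k] /andP[_ /andP[_ cl]].
have [->//|n1] := eqVneq _ ((1, 0, 0) : psc).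
have [->//|n2] := eqVneq _ ((1, 1, 0) : psc); rewrite ?orbT //.
rewrite /= /psc_edge /= eq_sym n1 eq_sym n2 /psc_close /= cl !andbT.
by case: b {n1 n2 cl} => [[|[]]] // ib; rewrite ?orbT.
Qed.

End PrismStrongCycle.

Theorem theorem1p7 :
  (forall G : sgraph,
     connected G -> vertex_transitive G -> 3 <= #|G| ->
     forall (l : nat) (p : seq G),
       l <= 2 -> induced_path l p -> closes_to_induced_cycle p) /\
  (forall l : nat, 3 <= l ->
     exists F : nat -> sgraph,
       (forall i j : nat, i <> j -> ~ graph_iso (F i) (F j)) /\
       (forall i : nat,
          [/\ connected (F i), vertex_transitive (F i) &
              exists p : seq (F i),
                induced_path l p /\ ~ closes_to_induced_cycle p])).
Proof.
split=> [G cG tG nG l p|[|[|[|l]]] // _]; first exact: short_induced_path_closes.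
(* The path length is now [l.+3]: two steps in layer 0, then [l.+1] tail vertices, which fit below
   the cycle parameter. Different [i] give different orders. *)
exists (fun i => psc (l.+3 + i)); split=> [i j ij [f [fbij _]]|i].
  by have := bij_eq_card fbij; rewrite !psc_card; lia.
split; [exact: psc_connected|exact: psc_vertex_transitive|].
have /psc_path_chordless ch : l.+1 <= l.+3 + i by lia.
eexists; split; last exact: dominated_end_not_closes ch (@psc_path_dominated _).
by have := chordless_induced_path ch; rewrite /= size_map size_iota.
Qed.
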